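(* For all integers $n\geq 3$ and $r\geq 1$ there exists an integer $s$ such that every even carousel of order $s$ on $n$ sets and every odd carousel of order $s$ on $n$ sets has rankwidth at least $r$.
   Context: All graphs are finite and simple. Let $X=\{u^1,\dots,u^k\}$ and $X'=\{v^1,\dots,v^k\}$ be two disjoint ordered sets of $k$ vertices of a graph $G$. The triple $(G,X,X')$ is called: - a regular matching if for all $j,j'\in\{1,\dots,k\}$: $u^jv^{j'}\in E(G)$ iff $j=j'$; - a regular antimatching if: $u^jv^{j'}\in E(G)$ iff $j\neq j'$; - a regular crossing if: $u^jv^{j'}\in E(G)$ iff $j+j'\geq k+1$; - an expanding matching if: $u^jv^{j'}\in E(G)$ iff $j'=2j$ or $j'=2j+1$; - an expanding antimatching if: $u^jv^{j'}\in E(G)$ iff $j'\neq 2j$ and $j'\neq 2j+1$; - an expanding crossing if: $u^jv^{j'}\in E(G)$ iff $2j+j'\geq 2k+2$; - (when $k\equiv 2 \pmod 4$) a skew expanding matching if, for all $j'\in\{1,\dots,k\}$: for $1\le j\le (k-2)/4$, $u^jv^{j'}\in E(G)$ iff $j'\in\{2j,2j+1\}$; for $(k-2)/4< j\le (3k+2)/4$, $u^jv^{j'}\notin E(G)$; for $(3k+2)/4<j\le k$, $u^jv^{j'}\in E(G)$ iff $j'\in\{2j-k-2,2j-k-1\}$; - (when $k\equiv 2\pmod 4$) a skew expanding antimatching if it is defined as the skew expanding matching except that for $(k-2)/4< j\le (3k+2)/4$, $u^jv^{j'}\in E(G)$ for all $j'$; - (when $k\equiv 2\pmod 4$) a skew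 expanding crossing if, for all $j'\in\{1,\dots,k\}$: for $1\le j\le (k-2)/4$, $u^jv^{j'}\in E(G)$ iff $2j+j'\geq k$; for $(k-2)/4<j\le k/2$, iff $j'\geq k/2+1$; for $k/2<j\le (3k+2)/4$, iff $j'\geq k/2-1$; for $(3k+2)/4<j\le k$, iff $2j+j'-2\geq 2k$. A triple is regular (resp. expanding, skew expanding) if it is one of the three regular (resp. expanding, skew expanding) kinds. Crossings (regular, expanding or skew expanding) are called cross triples; matchings and antimatchings are parallel triples. A carousel on $n\geq 3$ sets of cardinality $k$ is a graph $G$ with $V(G)=X_1\cup\dots\cup X_n$ (disjoint), each $X_i=\{x_i^1,\dots,x_i^k\}$ ordered, such that $(G,X_1,X_2)$ is a regular crossing, $(G,X_i,X_{i+1})$ is a regular triple for every $i\in\{2,\dots,n-1\}$, and $(G,X_n,X_1)$ is an expanding or skew expanding triple. Edges inside the $X_i$ and between $X_i,X_j$ with $j\notin\{i-1,i,i+1\}$ (indices mod $n$) are arbitrary. For an integer $s\geq1$, an even carousel of order $s$ on $n$ sets is a carousel with $k=2^s-1$, an even number of cross triples among $(G,X_i,X_{i+1})$, $i=1,\dots,n$ (indices mod $n$, so $(G,X_n,X_1)$ is included), and $(G,X_n,X_1)$ expanding. An odd carousel of order $s$ on $n$ sets is a carousel with $k=2(2^s-1)$, an odd number of cross triples among these $n$ triples, and $(G,X_n,X_1)$ skew expanding. Rankwidth: for disjoint $Y,Z\subseteq V(G)$, $\mathrm{rk}_G(Y,Z)$ is the rank over $\mathrm{GF}(2)$ of the 0-1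 matrix with rows indexed by $Y$, columns by $Z$, entry $1$ iff the two vertices are adjacent. A tree decomposition of $G$ is a cubic tree $T$ (at least two nodes, every non-leaf node of degree 3) whose leaf set is $V(G)$; each edge $e$ of $T$ splits the leaves into $(A_e,B_e)$ and has width $\mathrm{rk}_G(A_e,B_e)$; the width of $T$ is its maximum edge width; the rankwidth of $G$ is the minimum width of a tree decomposition (and $0$ if $|V(G)|\le 1$). *)

(* Defs.v *)
From HB Require Import structures.
From mathcomp Require Import all_boot all_order all_algebra.
From mathcomp Require Import boolp.

Set Implicit Arguments.
Unset Strict Implicit.
Unset Printing Implicit Defensive.

Record sgraph := SGraph {
  vert :> finType;
  adj : rel vert;
  adj_sym : symmetric adj;
  adj_irr : irreflexive adj }.

Arguments adj {s} _ _.

(* The families [u] and [v] are indexed by ['I_k], i.e. from 0; the pattern   *)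
(* [P] is a relation on the 1-based indices [1, ..., k] of the vertices.      *)
Definition follows (G : sgraph) (k : nat) (P : rel nat) (u v : 'I_k -> G) :=
  [forall j : 'I_k, forall j' : 'I_k, adj (u j) (v j') == P j.+1 j'.+1].

Section Triples.
Variables (G : sgraph) (k : nat).
Implicit Types u v : 'I_k -> G.

Definition regular_matching u v :=
  follows (fun j j' => j == j') u v.

Definition regular_antimatching u v :=
  follows (fun j j' => j != j') u v.

Definition regular_crossing u v :=
  follows (fun j j' => k + 1 <= j + j') u v.

Definition expanding_matching u v :=
  follows (fun j j' => (j' == 2 * j) || (j' == 2 * j + 1)) u v.

Definition expanding_antimatching u v :=
  follows (fun j j' => (j' != 2 * j) && (j' != 2 * j + 1)) u v.

Definition expanding_crossing u v :=
  follows (fun j j' => 2 * k + 2 <= 2 * j + j') u v.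

(* The divisions and subtractions below are exact whenever they are used,     *)
(* because [k] is congruent to 2 modulo 4.                                    *)
Definition skew_expanding_matching u v :=
  (k == 2 %[mod 4]) &&
  follows (fun j j' =>
    if j <= (k - 2) %/ 4 then (j' == 2 * j) || (j' == 2 * j + 1)
    else if j <= (3 * k + 2) %/ 4 then false
    else (j' == 2 * j - k - 2) || (j' == 2 * j - k - 1)) u v.

Definition skew_expanding_antimatching u v :=
  (k == 2 %[mod 4]) &&
  follows (fun j j' =>
    if j <= (k - 2) %/ 4 then (j' == 2 * j) || (j' == 2 * j + 1)
    else if j <= (3 * k + 2) %/ 4 then true
    else (j' == 2 * j - k - 2) || (j' == 2 * j - k - 1)) u v.

Definition skew_expanding_crossing u v :=
  (k == 2 %[mod 4]) &&
  follows (fun j j' =>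
    if j <= (k - 2) %/ 4 then k <= 2 * j + j'
    else if j <= k %/ 2 then k %/ 2 + 1 <= j'
    else if j <= (3 * k + 2) %/ 4 then k %/ 2 - 1 <= j'
    else 2 * k <= 2 * j + j' - 2) u v.

Definition regular_triple u v :=
  [|| regular_matching u v, regular_antimatching u v | regular_crossing u v].

Definition expanding_triple u v :=
  [|| expanding_matching u v, expanding_antimatching u v
    | expanding_crossing u v].

Definition skew_expanding_triple u v :=
  [|| skew_expanding_matching u v, skew_expanding_antimatching u v
    | skew_expanding_crossing u v].

Definition cross_triple u v :=
  [|| regular_crossing u v, expanding_crossing u v
    | skew_expanding_crossing u v].

End Triples.

(* [x i j] is the vertex x_{i+1}^{j+1}.  Bijectivity says that the sets X_i   *)
(* have cardinality k, are pairwise disjoint and cover V(G).  [ordS] is the   *)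
(* cyclic successor on ['I_n].                                                *)
Definition carousel (n k : nat) (G : sgraph) (x : 'I_n -> 'I_k -> G) : Prop :=
  [/\ bijective (fun p : 'I_n * 'I_k => x p.1 p.2),
      forall i : 'I_n, i = 0 :> nat -> regular_crossing (x i) (x (ordS i)),
      forall i : 'I_n, 0 < i < n.-1 -> regular_triple (x i) (x (ordS i)) &
      forall i : 'I_n, i = n.-1 :> nat ->
        expanding_triple (x i) (x (ordS i)) ||
        skew_expanding_triple (x i) (x (ordS i))].

Definition n_cross (n k : nat) (G : sgraph) (x : 'I_n -> 'I_k -> G) : nat :=
  #|[set i : 'I_n | cross_triple (x i) (x (ordS i))]|.

Definition even_carousel (n s : nat) (G : sgraph) : Prop :=
  exists x : 'I_n -> 'I_(2 ^ s - 1) -> G,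
    [/\ carousel x, ~~ odd (n_cross x) &
        forall i : 'I_n, i = n.-1 :> nat ->
          expanding_triple (x i) (x (ordS i))].

Definition odd_carousel (n s : nat) (G : sgraph) : Prop :=
  exists x : 'I_n -> 'I_(2 * (2 ^ s - 1)) -> G,
    [/\ carousel x, odd (n_cross x) &
        forall i : 'I_n, i = n.-1 :> nat ->
          skew_expanding_triple (x i) (x (ordS i))].

Definition cutrank (G : sgraph) (Y Z : {set G}) : nat :=
  \rank (\matrix_(i < #|Y|, j < #|Z|)
           ((adj (enum_val i) (enum_val j))%:R : 'F_2))%R.

Definition degree (G : sgraph) (x : G) : nat := #|[set y | adj x y]|.

Definition leaf (G : sgraph) (x : G) : bool := degree x == 1.

Definition connected_graph (G : sgraph) : Prop :=
  forall x y : G, connect adj x y.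

Definition acyclic_graph (G : sgraph) : Prop :=
  forall c : seq G, 2 < size c -> ~ ucycle adj c.

Definition cubic_tree (T : sgraph) : Prop :=
  [/\ connected_graph T, acyclic_graph T, 1 < #|T| &
      forall t : T, ~~ leaf t -> degree t = 3].

(* The leaves of the tree are identified with V(G) through [td_leaf]. *)
Record tree_decomposition (G : sgraph) := TreeDecomposition {
  td_tree : sgraph;
  td_cubic : cubic_tree td_tree;
  td_leaf : G -> td_tree;
  td_leaf_inj : injective td_leaf;
  td_leafP : forall t, leaf t = (t \in codom td_leaf) }.

Definition adj_del (T : sgraph) (a b : T) : rel T :=
  [rel x y | adj x y && ([set x; y] != [set a; b])].

Definition td_side (G : sgraph) (D : tree_decomposition G) (a b : td_tree D)
    : {set G} :=
  [set v | connect (adj_del a b) a (td_leaf D v)].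

Definition td_width (G : sgraph) (D : tree_decomposition G) : nat :=
  \max_(ab : td_tree D * td_tree D | adj ab.1 ab.2)
     cutrank (td_side ab.1 ab.2) (td_side ab.2 ab.1).

Section Existence.

Lemma card_sum_pred (A B : finType) (P : pred (A + B)) :
  #|[set z | P z]| = #|[set a | P (inl a)]| + #|[set b | P (inr b)]|.
Proof.
rewrite -!sum1dep_card.
by rewrite big_sumType.
Qed.

Section Grow.
Variables (T : sgraph) (v0 : T).

(* Hangs two new pendant vertices on [v0]; when [v0] is a leaf this keeps a   *)
(* cubic tree cubic and adds one leaf.                                        *)
Definition grow_adj : rel (T + bool) := fun x y =>
  match x, y with
  | inl a, inl b => adj a b
  | inl a, inr _ => a == v0
  | inr _, inl b => b == v0
  | inr _, inr _ => false
  end.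

Lemma grow_sym : symmetric grow_adj.
Proof. by move=> [a|b] [c|d] //=; apply: adj_sym. Qed.

Lemma grow_irr : irreflexive grow_adj.
Proof. by move=> [a|b] //=; apply: adj_irr. Qed.

Definition grow := SGraph grow_sym grow_irr.

Lemma grow_connected : connected_graph T -> connected_graph grow.
Proof.
move=> cT.
have cs : connect_sym (@adj grow) by apply: sym_connect_sym; exact: grow_sym.
have c0 (x : grow) : connect adj (inl v0 : grow) x.
  case: x => [a|b]; last by apply: connect1; rewrite /= eqxx.
  have /connectP[p pp ->] := cT v0 a.
  apply/connectP; exists (map inl p); last by rewrite last_map.
  by rewrite path_map.
by move=> x y; apply: connect_trans (c0 y); rewrite cs.
Qed.

Lemma grow_acyclic : acyclic_graph T -> acyclic_graph grow.
Proof.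
move=> aT c sc uc.
case: (boolP (all (fun z : grow => if z is inl _ then true else false) c)).
  move=> al; pose c' := pmap (fun z : grow => if z is inl a then Some a else None) c.
  have Ec : c = map inl c'.
    by rewrite /c'; elim: (c) al => [|[a|b] l IH] //= /IH {1}->.
  apply: (aT c'); first by move: sc; rewrite Ec size_map.
  move: uc; rewrite Ec /ucycle /= map_inj_uniq; last by move=> ? ? [].
  move=> /andP[cy ->]; rewrite andbT.
  by move: cy; case: (c') => //= a l; rewrite -map_rcons path_map.
rewrite -has_predC => /hasP[[a|b] bc] // _.
have [i c' Ec] := rot_to bc.
have : ucycle (@adj grow) (rot i c) by rewrite rot_ucycle.
have : 2 < size (rot i c) by rewrite size_rot.
rewrite Ec; case: c' {Ec} => [|y c'] //; case/lastP: c' => [|c' z] // _.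
case/andP; rewrite /= rcons_path last_rcons => /andP[e1] /andP[_ e2].
case: y e1 => [y|//] /= /eqP ->; case: z e2 => [z|//] /= /eqP ->.
by rewrite mem_rcons inE eqxx /= andbF.
Qed.

Lemma grow_degree_inl (a : T) :
  degree (inl a : grow) = degree a + (a == v0) * 2.
Proof.
rewrite /degree card_sum_pred /=; congr (_ + _).
case: eqP => _ /=; last by apply: eq_card0 => b; rewrite inE.
by rewrite mul1n -card_bool; apply: eq_card => b; rewrite !inE.
Qed.

Lemma grow_degree_inr (b : bool) : degree (inr b : grow) = 1.
Proof.
rewrite /degree card_sum_pred /=.
rewrite [X in _ + X]eq_card0 ?addn0; last by move=> d; rewrite inE.
by rewrite -(cards1 v0); apply: eq_card => d; rewrite !inE.
Qed.

Lemma grow_cubic : leaf v0 -> cubic_tree T -> cubic_tree grow.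
Proof.
move=> l0 [cT aT nT dT]; split.
- exact: grow_connected.
- exact: grow_acyclic.
- by rewrite card_sum card_bool addn2.
move=> [a|b]; rewrite /leaf; last by rewrite grow_degree_inr.
rewrite grow_degree_inl; case: (a =P v0) => [->|_]; first by rewrite (eqP l0).
by rewrite mul0n addn0; apply: dT.
Qed.

Lemma grow_leaves : leaf v0 ->
  #|[set t : grow | leaf t]| = #|[set t : T | leaf t]|.+1.
Proof.
move=> l0; rewrite card_sum_pred.
rewrite [X in _ + X](_ : _ = 2); last first.
  by rewrite -card_bool; apply: eq_card => b; rewrite !inE /leaf grow_degree_inr.
rewrite [in RHS](cardsD1 v0) inE l0 addn2 /=; do 2!congr (_.+1).
apply: eq_card => a; rewrite !inE /leaf grow_degree_inl.
case: (a =P v0) => [->|_] /=; first by rewrite (eqP l0).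
by rewrite mul0n addn0.
Qed.

End Grow.

Lemma edge_sym : symmetric (fun x y : bool => x != y).
Proof. by move=> [] []. Qed.
Lemma edge_irr : irreflexive (fun x y : bool => x != y).
Proof. by move=> []. Qed.

Definition edge_graph := SGraph edge_sym edge_irr.

Lemma edge_leaf (t : edge_graph) : leaf t.
Proof.
apply/eqP; rewrite /degree -(cards1 (~~ t)); apply: eq_card => y.
by rewrite !inE; case: t y => [] [].
Qed.

Lemma cubic_tree_exists (m : nat) :
  exists T : sgraph, cubic_tree T /\ #|[set t : T | leaf t]| = m.+2.
Proof.
elim: m => [|m [T [cT nT]]].
  exists edge_graph; split; last first.
    by rewrite -card_bool; apply: eq_card => t; rewrite !inE edge_leaf.
  split; first by move=> [] []; rewrite ?connect0 // connect1.
  - move=> c sc /andP[_ /card_uniqP uc].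
    by have := max_card (mem c); rewrite uc card_bool leqNgt sc.
  - by rewrite card_bool.
  by move=> t; rewrite edge_leaf.
have /card_gt0P[v0] : 0 < #|[set t : T | leaf t]| by rewrite nT.
rewrite inE => l0; exists (grow v0); split; first exact: grow_cubic.
by rewrite grow_leaves // nT.
Qed.

Lemma tree_decomposition_exists (G : sgraph) :
  1 < #|G| -> inhabited (tree_decomposition G).
Proof.
move=> nG; have [T [cT nT]] := cubic_tree_exists (#|G| - 2).
have E : #|G| = #|[set t : T | leaf t]| by rewrite nT -addn2 subnK.
pose f (x : G) : T := enum_val (cast_ord E (enum_rank x)).
have fI : injective f.
  by move=> x y /enum_val_inj /cast_ord_inj /enum_rank_inj.
constructor; apply: (@TreeDecomposition G T cT f fI) => t.
apply/idP/codomP => [lt|[x ->]]; last first.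
  by have := enum_valP (cast_ord E (enum_rank x)); rewrite inE.
have lt' : t \in [set t : T | leaf t] by rewrite inE.
exists (enum_val (cast_ord (esym E) (enum_rank_in lt' t))).
by rewrite /f enum_valK cast_ordKV enum_rankK_in.
Qed.

End Existence.

(* The first disjunct makes the rankwidth 0 when |V(G)| <= 1, where no tree    *)
(* decomposition exists.                                                      *)
Definition has_width (G : sgraph) (w : nat) : bool :=
  `[< (#|G| <= 1 /\ w = 0) \/
      (exists D : tree_decomposition G, td_width D = w) >].

Lemma has_width_exists (G : sgraph) : exists w, has_width G w.
Proof.
case: (leqP #|G| 1) => [le1|/tree_decomposition_exists[D]].
  by exists 0; apply/asboolP; left.
by exists (td_width D); apply/asboolP; right; exists D.
Qed.

Definition rankwidth (G : sgraph) : nat := ex_minn (has_width_exists G).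

(* Main.v *)
Require Import Defs.
From HB Require Import structures.
From mathcomp Require Import all_boot all_order all_algebra.
From mathcomp Require Import boolp zify.

Set Implicit Arguments.
Unset Strict Implicit.
Unset Printing Implicit Defensive.

(* A tree decomposition has an edge whose two sides each contain a third of   *)
(* the vertices; colour the vertices by their side.  If the cut-rank of this  *)
(* edge is w, then for each of the triples all but 2(w+1) indices match a     *)
(* vertex of one set to a vertex of the next one (of index j or k+1-j for     *)
(* regular triples, 2j or 2j+1 or their reflections for expanding ones) of    *)
(* the same colour: the exceptional pairs span a submatrix that is unit       *)
(* triangular up to adding a constant.  Going once around the carousel, the   *)
(* colour of the index j of X_1 agrees with those of 2j and 2j+1 (up to a     *)
(* reflection, in the odd case) with boundedly many exceptions, while the     *)
(* crossing (X_1, X_2) bounds the number of colour changes along X_1.  In the *)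
(* binary tree j -> 2j, 2j+1 the second fact makes some deep level            *)
(* monochromatic and the first propagates its colour below, so that fewer     *)
(* than a third of the vertices have the other colour.                        *)

(** Let [w] be the cut-rank of the edge given by [balanced_edge], and [B = 2 * w.+1]. By
    [mismatch_le], each triple matches indices of equal colour with at most [B] exceptions. These
    matchings are composed around the carousel ([transport]). A cross triple reverses the index
    order, so only the parity of the number of cross triples matters. If it is even, the reversals
    cancel and j in X_1 is matched with 2j and 2j+1 ([even_tree]). If it is odd, one reversal
    survives, and X_1 becomes a pair of binary trees rooted at its two ends, each parent being
    matched with children in the other tree ([odd_tree]).

    Since X_1 has few colour changes ([crossing_changes]), [dominant_colour] yields a colour missed
    by at most 9/32 of X_1, up to a constant. Transport spreads this colour to all the sets with
    bounded loss. As 9/32 is below the third that balance demands, [k] is bounded in terms of [n]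
    and [w] ([unbalanced]), which a large [s] forbids when [w < r]. *)

Lemma rank_near_triangular (F : fieldType) (m : nat) (A : 'M[F]_m) (c : F) :
    (forall i j : 'I_m, i < j -> A i j = c) ->
    (forall i, A i i != c) ->
  m <= (\rank A).+1.
Proof.
move=> Au Ad; pose J : 'M[F]_m := const_mx c.
have rJ : \rank J <= 1.
  have -> : J = (\col_(i < m) c *m \row_(i < m) (1 : F))%R.
    apply/matrixP => i j; rewrite !mxE big_ord1 !mxE GRing.mulr1 //.
  exact: leq_trans (mxrankM_maxr _ _) (rank_leq_row _).
(* Subtracting the constant matrix, of rank at most 1, leaves a triangular matrix with nonzero
   diagonal. *)
have tA : is_trig_mx (A - J)%R.
  by apply/is_trig_mxP => i j /Au; rewrite !mxE => ->; rewrite GRing.subrr.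
have uA : (A - J)%R \in unitmx.
  rewrite unitmxE (det_trig tA) GRing.unitfE.
  by apply/GRing.prodf_neq0 => i _; rewrite !mxE GRing.subr_eq0.
rewrite -[X in X <= _](mxrank_unit uA).
apply: leq_trans (mxrank_add _ _) _; rewrite mxrank_opp; lia.
Qed.

Lemma cutrank_ge_mx (G : sgraph) (Y Z : {set G}) (m p : nat)
    (a : 'I_m -> G) (b : 'I_p -> G) :
    (forall i, a i \in Y) -> (forall i, b i \in Z) ->
  \rank (\matrix_(i < m, j < p) ((adj (a i) (b j))%:R : 'F_2))%R
    <= cutrank Y Z.
Proof.
move=> aY bZ; rewrite /cutrank; set M := (X in _ <= \rank X).
pose f i := enum_rank_in (aY i) (a i); pose g i := enum_rank_in (bZ i) (b i).
have -> : (\matrix_(i < m, j < p) ((adj (a i) (b j))%:R : 'F_2))%R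
          = colsub g (rowsub f M).
  by apply/matrixP => i j; rewrite !mxE !enum_rankK_in.
rewrite -mxrank_tr trmx_mxsub; apply: leq_trans (mxrankS (rowsub_sub _ _)) _.
by rewrite mxrank_tr; apply: mxrankS; apply: rowsub_sub.
Qed.

(** Asking for [c] on just one side of the diagonal lets matchings, antimatchings and crossings all
    qualify; a transpose reduces the second alternative to the first. *)
Lemma size_split_le (G : sgraph) (Y Z : {set G}) (a b : nat -> G) (c : bool)
    (s : seq nat) :
    sorted ltn s ->
    {in s, forall p, (a p \in Y) && (b p \in Z)} ->
    {in s, forall p, adj (a p) (b p) = ~~ c} ->
    {in s &, forall p q, p < q -> adj (a p) (b q) = c} \/
    {in s &, forall p q, p < q -> adj (a q) (b p) = c} ->
  size s <= (cutrank Y Z).+1.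
Proof.
move=> ss sYZ dg off.
have ms (i : 'I_(size s)) : nth 0 s i \in s by rewrite mem_nth.
pose A : 'M['F_2]_(size s) :=
  (\matrix_(i, j) (adj (a (nth 0 s i)) (b (nth 0 s j)))%:R)%R.
have lt_nth (i j : 'I_(size s)) : i < j -> nth 0 s i < nth 0 s j.
  by move=> ij; apply: (sorted_ltn_nth ltn_trans) => //; rewrite inE.
have rA : size s <= (\rank A).+1.
  case: off => off.
    apply: (@rank_near_triangular _ _ A (c%:R)%R) => [i j ij|i].
      by rewrite mxE off // lt_nth.
    by rewrite mxE dg //; case: (c).
  rewrite -mxrank_tr; apply: (@rank_near_triangular _ _ A^T%R (c%:R)%R) => [i j ij|i].
    by rewrite !mxE off // lt_nth.
  by rewrite !mxE dg //; case: (c).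
apply: leq_trans rA _; rewrite ltnS; apply: cutrank_ge_mx => i.
- by have /andP[] := sYZ _ (ms i).
- by have /andP[] := sYZ _ (ms i).
Qed.

Definition mismatch (s : seq nat) (f g : nat -> bool) :=
  count (fun j => f j != g j) s.

(** The mismatched indices split by which of [a p] and [b p] lies in [Y]. Each class gives a nearly
    triangular submatrix of the cut, with [a] and [b] exchanged for the second class. *)
Lemma mismatch_le (G : sgraph) (Y Z : {set G}) (a b : nat -> G) (c : bool)
    (s : seq nat) :
    ~: Y \subset Z -> sorted ltn s ->
    {in s, forall p, adj (a p) (b p) = ~~ c} ->
    {in s &, forall p q, p < q -> adj (a p) (b q) = c} \/
    {in s &, forall p q, p < q -> adj (a q) (b p) = c} ->
  mismatch s (fun p => a p \in Y) (fun p => b p \in Y)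
    <= 2 * (cutrank Y Z).+1.
Proof.
move=> /subsetP YZ ss dg off.
have inZ v : v \notin Y -> v \in Z by move=> vY; apply: YZ; rewrite inE.
pose s1 := [seq p <- s | (a p \in Y) && (b p \notin Y)].
pose s2 := [seq p <- s | (b p \in Y) && (a p \notin Y)].
have -> : mismatch s (fun p => a p \in Y) (fun p => b p \in Y)
          = size s1 + size s2.
  rewrite /mismatch !size_filter -count_predUI.
  rewrite [X in _ = _ + X](_ : _ = 0) ?addn0; last first.
    by apply/eqP; rewrite -leqn0 leqNgt -has_count; apply/hasPn => p _ /=;
       case: (a p \in Y); rewrite ?andbF.
  by apply: eq_count => p /=; case: (a p \in Y); case: (b p \in Y).
have sub1 p : p \in s1 -> p \in s by rewrite mem_filter => /andP[].
have sub2 p : p \in s2 -> p \in s by rewrite mem_filter => /andP[].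
rewrite mul2n -addnn; apply: leq_add.
  apply: (@size_split_le G Y Z a b c); first exact: sorted_filter ltn_trans _ _ _.
  - by move=> p; rewrite mem_filter => /andP[/andP[-> /inZ ->]].
  - by move=> p /sub1; apply: dg.
  - by case: off => off; [left|right] => p q /sub1 ? /sub1 ?; apply: off.
apply: (@size_split_le G Y Z b a c); first exact: sorted_filter ltn_trans _ _ _.
- by move=> p; rewrite mem_filter => /andP[/andP[-> /inZ ->]].
- by move=> p /sub2 ?; rewrite adj_sym; apply: dg.
- by case: off => off; [right|left] => p q /sub2 ? /sub2 ? ?;
    rewrite adj_sym; apply: off.
Qed.

(** * Sides of an edge and balanced edges of a cubic tree *)

Section TreeSides.
Variable T : sgraph.
Implicit Types a b c t : T.

Definition side a b : {set T} := [set t | connect (adj_del a b) a t].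

Lemma adj_delC a b : adj_del a b =2 adj_del b a.
Proof. by move=> x y; rewrite /adj_del /= [[set b; a]]setUC. Qed.

Lemma adj_del_neq a b x y : adj x y -> x != a -> y != a -> adj_del a b x y.
Proof.
move=> xy xa ya; rewrite /adj_del /= xy; apply/eqP => /setP/(_ a).
by rewrite !inE eqxx ![a == _]eq_sym (negbTE xa) (negbTE ya).
Qed.

Lemma side_cover a b : connected_graph T -> ~: side a b \subset side b a.
Proof.
move=> cT; apply/subsetP => t; rewrite !inE => nat'.
suff : connect (adj_del a b) a t || connect (adj_del a b) b t.
  by rewrite (negbTE nat') /= (eq_connect (adj_delC a b)).
have /connectP[p pp ->] := cT a t.
elim/last_ind: p pp {nat'} => [|p z IH]; first by rewrite connect0.
rewrite rcons_path last_rcons => /andP[/IH IHp e].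
have [E|ne] := eqVneq [set last a p; z] [set a; b].
  have : z \in [set a; b] by rewrite -E !inE eqxx orbT.
  by rewrite !inE => /orP[]/eqP ->; rewrite connect0 ?orbT.
have st : adj_del a b (last a p) z by apply/andP.
by case/orP: IHp => h; rewrite (connect_trans h (connect1 st)) ?orbT.
Qed.

Lemma side_notin a b : acyclic_graph T -> adj a b -> b \notin side a b.
Proof.
move=> aT ab; apply/negP; rewrite inE => /connectP[p0 pp0].
case/shortenP: pp0 => p pp up _ lb.
have pa : path adj a p by apply: sub_path pp => x y /andP[].
apply: (aT (a :: p)).
  case: p pp up lb {pa} => [|x [|y p]] //=; first by move=> _ _ E; rewrite E adj_irr in ab.
  by rewrite andbT => /andP[_ /eqP ne] _ E; case: ne; rewrite E.
by rewrite /ucycle up andbT /= rcons_path pa -lb adj_sym.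
Qed.

Lemma side_sub a b c : acyclic_graph T -> adj a b -> adj a c -> c != b ->
  side c a \proper side a b.
Proof.
move=> aT ab ac cb; have naS : a \notin side c a by apply: side_notin; rewrite 1?adj_sym.
apply/properP; split; last by exists a; rewrite // inE connect0.
apply/subsetP => t; rewrite [t \in side a b]inE inE => /connectP[p pp ->].
have acd : adj_del a b a c.
  rewrite /adj_del /= ac; apply/eqP => /setP/(_ c); rewrite !inE eqxx orbT (negbTE cb) orbF.
  by move/esym/eqP=> E; rewrite E adj_irr in ac.
elim/last_ind: p pp => [|p z IH]; first by move=> _; apply: connect1.
rewrite rcons_path last_rcons => /andP[pp e].
apply: connect_trans (IH pp) (connect1 _).
have lS : last c p \in side c a by rewrite inE; apply/connectP; exists p.
have zS : z \in side c a.
  by move: lS; rewrite !inE => lS; apply: connect_trans lS (connect1 e).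
apply: adj_del_neq; first by case/andP: e.
- by apply: contraNneq naS => E; rewrite -{1}E.
- by apply: contraNneq naS => E; rewrite -{1}E.
Qed.

Lemma side_split a b t : t \in side a b -> t != a ->
  exists2 c, adj a c && (c != b) & t \in side c a.
Proof.
rewrite inE => /connectP[p0 pp0]; case/shortenP: pp0 => p pp up _ lt ta.
case: p pp up lt => [|c p] /=; first by move=> _ _ E; rewrite E eqxx in ta.
case/andP=> /andP[ac ne] pp /andP[na _] lt.
exists c; first by rewrite ac; apply: contraNneq ne => ->.
rewrite inE; apply/connectP; exists p => //.
suff avoid x q : path (adj_del a b) x q -> a \notin x :: q -> path (adj_del c a) x q.
  exact: avoid.
elim: q x => //= y q IH x /andP[/andP[xy _] pq].
rewrite !inE !negb_or => /and3P[ax ay aq].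
rewrite IH ?inE ?negb_or ?ay // andbT -/(adj_del c a x y) adj_delC.
by apply: adj_del_neq; rewrite // eq_sym.
Qed.

End TreeSides.

Lemma cubic_tree_edge (T : sgraph) : cubic_tree T -> exists a b : T, adj a b.
Proof.
case=> cT _ nT dT.
have /card_gt0P[a _] : 0 < #|T| by apply: ltnW.
have : 0 < degree a by have [/eqP-> //|/dT->] := boolP (leaf a).
by case/card_gt0P=> b; rewrite inE => ab; exists a, b.
Qed.

(** Take a smallest side holding a third of the vertices. Were the other side below a third, this
    one would exceed two thirds; but the two branches beyond its end [a] are each below a third by
    minimality, and a leaf [a] carries a single vertex. *)
Lemma balanced_edge (G : sgraph) (D : tree_decomposition G) : 3 < #|G| ->
  exists a b : td_tree D, [/\ adj a b,
    #|G| <= 3 * #|td_side a b| & #|G| <= 3 * #|~: td_side a b|].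
Proof.
move=> nG; have [cT aT _ dT] := td_cubic D.
have sideE (a b : td_tree D) v : (v \in td_side a b) = (td_leaf D v \in side a b).
  by rewrite !inE.
pose P (ab : td_tree D * td_tree D) :=
  adj ab.1 ab.2 && (#|G| <= 3 * #|td_side ab.1 ab.2|).
have [ab0 P0] : exists ab, P ab.
  have [a [b ab]] := cubic_tree_edge (td_cubic D).
  have : #|~: td_side a b| <= #|td_side b a|.
    apply: subset_leq_card; apply/subsetP => v; rewrite inE !sideE => h.
    by apply: (subsetP (side_cover a b cT)); rewrite inE.
  have := cardsC (td_side a b) => E le.
  case: (leqP #|G| (3 * #|td_side a b|)) => h; first by exists (a, b); rewrite /P ab.
  exists (b, a); apply/andP; split; first by rewrite /= adj_sym.
  change (is_true (#|G| <= 3 * #|td_side b a|)); lia.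
(* Tree nodes are minimised, not vertices of [G]: by [side_sub] their number drops strictly when
   moving on to the next edge. *)
case: (arg_minnP (fun ab => #|side ab.1 ab.2|) P0) => -[a b] /andP[/= ab Sab] minab.
exists a, b; split=> //; have := cardsC (td_side a b) => E.
case: (leqP #|G| (3 * #|~: td_side a b|)) => // lt.
have small c : adj a c && (c != b) -> 3 * #|td_side c a| < #|G|.
  case/andP=> ac cb; rewrite ltnNge; apply/negP => big.
  have := minab (c, a); rewrite /P /= adj_sym ac big => /(_ isT).
  by rewrite leqNgt proper_card // side_sub.
have cov v : v \in td_side a b -> td_leaf D v != a ->
    exists2 c, adj a c && (c != b) & v \in td_side c a.
  by rewrite sideE => vS va; have [c ? ?] := side_split vS va; exists c; rewrite ?sideE.
have [la|/dT d3] := boolP (leaf a).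
  have : #|td_side a b| <= 1.
    move: (la); rewrite td_leafP => /codomP[w aw].
    have sub v : v \in td_side a b -> v = w.
      move=> vS; apply: (@td_leaf_inj _ D); rewrite -aw; apply/eqP/negPn/negP => va.
      have [c /andP[ac cb] _] := cov _ vS va.
      move: la; rewrite /leaf /degree => /cards1P[z /setP Ez].
      have := Ez b; have := Ez c; rewrite !inE ab ac => /esym/eqP Ec /esym/eqP Eb.
      by rewrite Ec Eb eqxx in cb.
    rewrite -(cards1 w); apply: subset_leq_card; apply/subsetP => v /sub ->.
    by rewrite inE.
  lia.
have : #|[set c | adj a c] :\ b| = 2.
  by move: d3; rewrite /degree (cardsD1 b) inE ab => -[].
move/eqP/cards2P => [c [d [_ Ecd]]].
have nb z : (adj a z && (z != b)) = (z == c) || (z == d).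
  by have /setP/(_ z) := Ecd; rewrite !inE andbC.
have : #|td_side a b| <= #|td_side c a| + #|td_side d a|.
  apply: leq_trans (leq_card_setU _ _); apply: subset_leq_card; apply/subsetP => v vS.
  have va : td_leaf D v != a.
    apply/eqP => va; have : leaf a by rewrite td_leafP -va codom_f.
    by rewrite /leaf d3.
  have [z zn zS] := cov _ vS va; move: zn; rewrite nb in_setU.
  by case/orP => /eqP <-; rewrite zS ?orbT.
have := small c; have := small d; rewrite !nb !eqxx orbT => /(_ isT) ? /(_ isT) ?.
lia.
Qed.

(** * Counting mismatches over index intervals *)

Lemma mismatchE k (f g : nat -> bool) :
  mismatch (iota 1 k) f g = \sum_(1 <= j < k.+1) (f j != g j).
Proof.
rewrite /mismatch -sum1_count big_mkcond /index_iota subSS subn0.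
by apply: eq_bigr => j _; case: eqP.
Qed.

Lemma mismatchC s f g : mismatch s f g = mismatch s g f.
Proof. by apply: eq_count => j /=; rewrite eq_sym. Qed.

Lemma mismatch_trans g s f h :
  mismatch s f h <= mismatch s f g + mismatch s g h.
Proof.
rewrite /mismatch -count_predUI; apply: leq_trans (leq_addr _ _).
by apply: sub_count => j /=; case: (f j); case: (g j); case: (h j).
Qed.

Lemma mismatch_prefix m k f g : m <= k ->
  mismatch (iota 1 m) f g <= mismatch (iota 1 k) f g.
Proof. by move=> /subnKC <-; rewrite /mismatch iotaD count_cat leq_addr. Qed.

Lemma mismatch_rev k f g :
  mismatch (iota 1 k) (fun j => f (k.+1 - j)) (fun j => g (k.+1 - j))
  = mismatch (iota 1 k) f g.
Proof.
by rewrite !mismatchE [RHS]big_nat_rev.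
Qed.

Lemma eq_in_mismatch s f g f' g' :
  {in s, f =1 f'} -> {in s, g =1 g'} -> mismatch s f g = mismatch s f' g'.
Proof. by move=> ff gg; apply: eq_in_count => j js /=; rewrite ff ?gg. Qed.

(** Heap indexing of the binary tree: every node other than the root 1 is [2 * j] or [2 * j + 1] for
    a unique parent [j]. *)
Lemma sum_children (F : nat -> nat) t :
  \sum_(1 <= j < 2 ^ t.+1) F j
  = F 1 + \sum_(1 <= j < 2 ^ t) (F (2 * j) + F (2 * j + 1)).
Proof.
have t0 : 0 < 2 ^ t by rewrite expn_gt0.
rewrite expnS; elim: (2 ^ t) t0 => // -[|m] IH _.
  by rewrite big_nat1 [in RHS]big_nil addn0.
rewrite [in RHS]big_nat_recr //= [in RHS]addnA -IH //.
rewrite (_ : 2 * m.+2 = (2 * m.+1).+2); last by lia.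
by rewrite big_nat_recr // big_nat_recr /= ?[2 * m.+1 + 1]addn1 ?addnA //; lia.
Qed.

Lemma const_interval (f : nat -> bool) m p :
    \sum_(m <= j < p) (f j != f j.+1) = 0 ->
  forall j, m <= j <= p -> f j = f m.
Proof.
move=> S0 j; elim: j => [|j IH]; first by rewrite leqn0 => /andP[/eqP->].
case: (ltngtP m j.+1) => [mj|//|<-] //= jp.
move/eqP: S0; rewrite sum_nat_seq_eq0 => /allP/(_ j).
rewrite mem_index_iota /= => /(_ _); rewrite eqb0 negbK => /(_ _)/eqP <-; last by lia.
by apply: IH; lia.
Qed.

(** * A dominant colour in two interleaved binary trees *)

Section BinaryTree.
Variables (L R : nat -> bool) (C D s : nat).
Let node := iota 1 (2 ^ s.-1 - 1).
Hypothesis Lch : mismatch (iota 1 (2 ^ s - 2)) L (fun j => L j.+1) <= C.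
Hypothesis Rch : mismatch (iota 1 (2 ^ s - 2)) R (fun j => R j.+1) <= C.
Hypothesis LR : forall e : bool, mismatch node L (fun j => R (2 * j + e)) <= D.
Hypothesis RL : forall e : bool, mismatch node R (fun j => L (2 * j + e)) <= D.

Let bad (c : bool) t := \sum_(1 <= j < 2 ^ t) ((L j != c) + (R j != c)).

(** A child is wrong only if its parent, in the other colouring, is wrong or disagrees with it. Each
    parent has two children, each of the four kinds of disagreement occurs at most [D] times, and
    the two roots add 2. *)
Lemma bad_step c t : t < s -> bad c t.+1 <= 2 * bad c t + 4 * D + 2.
Proof.
move=> ts; rewrite /bad sum_children addnC.
have d1 : (L 1 != c) + (R 1 != c) <= 2 by case: (_ != c); case: (_ != c).
apply: leq_add d1.
have pre f g : \sum_(1 <= j < 2 ^ t) (f j != g j) <= mismatch node f g.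
  have : 2 ^ t - 1 <= 2 ^ s.-1 - 1 by apply: leq_sub2r; rewrite leq_exp2l //; lia.
  move/(mismatch_prefix f g); rewrite mismatchE; congr (_ <= _).
  by rewrite -subSn ?expn_gt0 // subSS subn0.
have a1 e : \sum_(1 <= j < 2 ^ t) (L j != R (2 * j + nat_of_bool e)) <= D.
  exact: leq_trans (pre _ _) (LR e).
have a2 e : \sum_(1 <= j < 2 ^ t) (R j != L (2 * j + nat_of_bool e)) <= D.
  exact: leq_trans (pre _ _) (RL e).
apply: leq_trans (_ : 2 * bad c t +
   (\sum_(1 <= j < 2 ^ t) (L j != R (2 * j + false)) +
    \sum_(1 <= j < 2 ^ t) (L j != R (2 * j + true)) +
    \sum_(1 <= j < 2 ^ t) (R j != L (2 * j + false)) +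
    \sum_(1 <= j < 2 ^ t) (R j != L (2 * j + true))) <= _); last first.
  by rewrite /bad; have := a1 false; have := a1 true; have := a2 false; have := a2 true; lia.
rewrite /bad big_distrr -!big_split /=; apply: leq_sum => j _.
rewrite !addn0.
move: (L j) (R j) (L (2 * j)) (R (2 * j)) (L (2 * j + 1)) (R (2 * j + 1)).
by case: c => -[] [] [] [] [] [].
Qed.

Lemma bad_iter c t i : t + i <= s ->
  bad c (t + i) + (4 * D + 2) <= 2 ^ i * (bad c t + (4 * D + 2)).
Proof.
elim: i => [|i IH]; first by rewrite addn0 mul1n.
rewrite addnS => h; have := bad_step c h; have := IH (ltnW h); rewrite expnS; lia.
Qed.

(* The disjoint blocks [2^l, 2^(l+2)), l = l0, l0+2, ..., outnumber the colour *)
(* changes of L and R, so one of them is free of changes.                      *)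
Lemma dominant_colour l0 : 8 * (2 * D + 1) <= 2 ^ l0 ->
    s = l0 + 2 * (2 * C + 1) + 1 ->
  exists c, 32 * bad c s <= 18 * 2 ^ s.
Proof.
move=> l0D sE.
pose ch j := (L j != L j.+1) + (R j != R j.+1).
have [m mC ch0] : exists2 m, m < 2 * C + 1 &
    \sum_(2 ^ (l0 + 2 * m) <= j < 2 ^ (l0 + 2 * m.+1)) ch j = 0.
  apply: contrapT => no.
  have tele M : \sum_(0 <= m < M)
      \sum_(2 ^ (l0 + 2 * m) <= j < 2 ^ (l0 + 2 * m.+1)) ch j
      = \sum_(2 ^ l0 <= j < 2 ^ (l0 + 2 * M)) ch j.
    elim: M => [|M IH]; first by rewrite big_nil addn0 big_geq.
    rewrite big_nat_recr //= IH -big_cat_nat //; rewrite leq_exp2l //; lia.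
  have lo : 2 * C + 1 <= \sum_(0 <= m < 2 * C + 1)
      \sum_(2 ^ (l0 + 2 * m) <= j < 2 ^ (l0 + 2 * m.+1)) ch j.
    rewrite -[X in X <= _]subn0 -[X in X <= _]muln1 -sum_nat_const_nat.
    rewrite !big_nat; apply: leq_sum => m /andP[_ mC].
    by rewrite lt0n; apply/eqP => e; apply: no; exists m.
  move: lo; rewrite tele leqNgt => /negP; apply.
  apply: leq_ltn_trans (_ : \sum_(1 <= j < (2 ^ s - 2).+1) ch j < _).
    have e1 : 1 <= 2 ^ l0 by rewrite expn_gt0.
    have e2 : 2 ^ (l0 + 2 * (2 * C + 1)) <= (2 ^ s - 2).+1.
      by rewrite sE [X in _ <= (X - _).+1]expnD expn1; have : 1 <= 2 ^ (l0 + 2 * (2 * C + 1)); [rewrite expn_gt0|lia].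
    have e3 : 2 ^ l0 <= 2 ^ (l0 + 2 * (2 * C + 1)) by rewrite leq_exp2l //; lia.
    rewrite [X in _ <= X](big_cat_nat (n := 2 ^ l0)) //=; last by lia.
    apply: leq_trans (leq_addl _ _).
    rewrite [X in _ <= X](big_cat_nat (n := 2 ^ (l0 + 2 * (2 * C + 1)))) //=.
    exact: leq_addr.
  by rewrite big_split /= -!mismatchE; lia.
set l := l0 + 2 * m in ch0.
have l0l : 2 ^ l0 <= 2 ^ l by rewrite leq_exp2l // leq_addr.
have lE : l0 + 2 * m.+1 = l.+2 by rewrite /l; lia.
rewrite lE in ch0; move: ch0; rewrite /ch big_split /= => /eqP.
rewrite addn_eq0 => /andP[/eqP L0 /eqP R0].
have cL := const_interval L0; have cR := const_interval R0.
have ls : l.+2 < s by rewrite /l; lia.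
have c01 : 0 < 2 ^ l by rewrite expn_gt0.
(* Otherwise all [2 ^ l] nodes of level [l] would disagree with their left children, which lie in
   the same block; but [D < 2 ^ l]. *)
have LRl : L (2 ^ l) = R (2 ^ l).
  apply/eqP/negPn/negP => ne.
  have : 2 ^ l <= D.
    apply: leq_trans (LR false).
    have : 2 ^ l.+1 - 1 <= 2 ^ s.-1 - 1 by apply: leq_sub2r; rewrite leq_exp2l //; lia.
    move/(mismatch_prefix L (fun j => R (2 * j + false))); apply: leq_trans.
    have -> : 2 ^ l.+1 - 1 = (2 ^ l - 1) + 2 ^ l by rewrite expnS; lia.
    rewrite /mismatch iotaD count_cat; apply: leq_trans (leq_addl _ _).
    have : all (fun j => L j != R (2 * j + false)) (iota (1 + (2 ^ l - 1)) (2 ^ l)).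
      apply/allP => j; rewrite mem_iota => h.
      have h1 : 2 ^ l <= j <= 2 ^ l.+2 by rewrite !expnS; lia.
      have h2 : 2 ^ l <= 2 * j + false <= 2 ^ l.+2 by rewrite !expnS addn0; lia.
      by rewrite (cL _ h1) (cR _ h2).
    by rewrite all_count => /eqP ->; rewrite size_iota.
  lia.
exists (L (2 ^ l)); set c := L (2 ^ l).
(* Only the fewer than [2 ^ l] indices above the block can be wrong, once in each colouring. *)
have b2 : bad c l.+2 <= 2 * 2 ^ l.
  rewrite /bad (big_cat_nat (n := 2 ^ l)) //=; last by rewrite leq_exp2l //; lia.
  rewrite [X in _ + X]big1_seq ?addn0; last first.
    move=> j; rewrite mem_index_iota /= => h.
    by rewrite cL ?cR -?LRl ?eqxx //; lia.
  apply: leq_trans (_ : \sum_(1 <= j < 2 ^ l) 2 <= _); last by rewrite sum_nat_const_nat; lia.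
  by apply: leq_sum => j _; case: (_ != c); case: (_ != c).
(* Since [4 * D + 2] is at most a quarter of [2 ^ l], the final proportion is (2 + 1/4) / 4 = 9/16
   of [2 ^ s]. *)
have := @bad_iter c l.+2 (s - l.+2); rewrite subnKC ?(ltnW ls) // => /(_ (leqnn _)).
have -> : 2 ^ s = 2 ^ (s - l.+2) * (4 * 2 ^ l).
  by rewrite -(expnD 2 2) -expnD; congr (_ ^ _); lia.
set q := 2 ^ (s - l.+2); set b := bad c l.+2 in b2 *; nia.
Qed.

End BinaryTree.

(* Indices are 1-based, as in the patterns; [d] is the junk value outside [1, k]. *)
Definition vertex_at (G : sgraph) (k : nat) (d : G) (u : 'I_k -> G) (j : nat) : G :=
  odflt d (omap u (insub j.-1)).

Lemma vertex_atE (G : sgraph) k (d : G) (u : 'I_k -> G) (i : 'I_k) :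
  vertex_at d u i.+1 = u i.
Proof. by rewrite /vertex_at /= valK. Qed.

Lemma followsE (G : sgraph) k (d : G) (P : rel nat) (u v : 'I_k -> G) :
    follows P u v -> forall j j', 0 < j <= k -> 0 < j' <= k ->
  adj (vertex_at d u j) (vertex_at d v j') = P j j'.
Proof.
move=> /forallP fP [|j] [|j'] //= jk jk'.
rewrite -[j]/(val (Ordinal jk)) -[j']/(val (Ordinal jk')) !vertex_atE.
by have /forallP/(_ (Ordinal jk'))/eqP := fP (Ordinal jk).
Qed.

Lemma follows_unique (G : sgraph) k (P Q : rel nat) (u v : 'I_k -> G) :
    follows P u v -> follows Q u v ->
  forall j j', 0 < j <= k -> 0 < j' <= k -> P j j' = Q j j'.
Proof.
move=> uP uQ [|j] [|j'] //= jk jk'; have d := u (Ordinal jk).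
by rewrite -(followsE d uP) ?(followsE d uQ).
Qed.

Definition flip (k : nat) (b : bool) (j : nat) := if b then k.+1 - j else j.

Lemma mismatch_flip k b f g :
  mismatch (iota 1 k) (fun j => f (flip k b j)) (fun j => g (flip k b j))
  = mismatch (iota 1 k) f g.
Proof. by case: b; rewrite // -[RHS]mismatch_rev. Qed.

(** * Colour transport across one triple *)

Section Transport.
Variables (G : sgraph) (Y Z : {set G}) (d : G) (k : nat).
Hypothesis YZ : ~: Y \subset Z.
Implicit Types u v : 'I_k -> G.
Let B := 2 * (cutrank Y Z).+1.
Let F u j := vertex_at d u j \in Y.

(* For small [k] a matching can also be a crossing, e.g. when [k = 1]. *)
Lemma cross_regular u v : 5 < k ->
  regular_triple u v -> cross_triple u v -> regular_crossing u v.
Proof.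
move=> k5 /or3P[] // uv /or3P[//|uv'|/andP[_ uv']] //.
all: have [h1 h2 h3] : [/\ 0 < 1 <= k, 0 < 2 <= k & 0 < (k - 2) %/ 4] by split; lia.
all: have := follows_unique uv uv' h1 h1; have := follows_unique uv uv' h1 h2; rewrite /= ?h3; lia.
Qed.

Lemma cross_expanding u v : 5 < k -> odd k ->
  expanding_triple u v -> cross_triple u v -> expanding_crossing u v.
Proof.
move=> k5 ok /or3P[] // uv /or3P[uv'|//|/andP[k4 _]] //; try lia.
(* Parallel patterns and crossings already differ at the index pairs (1, 1) or (1, 2). *)
all: have [h1 h2 h3] : [/\ 0 < 1 <= k, 0 < 2 <= k & 0 < (k - 2) %/ 4] by split; lia.
all: have := follows_unique uv uv' h1 h1; have := follows_unique uv uv' h1 h2; rewrite /= ?h3; lia.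
Qed.

Lemma cross_skew u v : 5 < k ->
  skew_expanding_triple u v -> cross_triple u v -> skew_expanding_crossing u v.
Proof.
move=> k5 /or3P[] // => /andP[k4 uv] /or3P[] // uv'.
all: have [h1 h2 h3] : [/\ 0 < 1 <= k, 0 < 2 <= k & 0 < (k - 2) %/ 4] by split; lia.
all: have := follows_unique uv uv' h1 h2; rewrite /= ?h3; lia.
Qed.

(** In a crossing the neighbours of [u^j] start at index [k.+1 - j], which is thus the diagonal of a
    triangular pattern; parallel triples keep [j]. *)
Lemma regular_transport u v : 5 < k -> regular_triple u v ->
  mismatch (iota 1 k) (F u) (fun j => F v (flip k (cross_triple u v) j)) <= B.
Proof.
move=> k5 reg; have [cr|ncr] := boolP (cross_triple u v).
  have uv := followsE d (cross_regular k5 reg cr).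
  apply: (@mismatch_le G Y Z (vertex_at d u) (fun j => vertex_at d v (k.+1 - j)) false) => //.
  - exact: iota_ltn_sorted.
  - by move=> p; rewrite mem_iota => h; rewrite uv; lia.
  - by left=> p q; rewrite !mem_iota => h h' pq; rewrite uv; lia.
case/or3P: reg => [uv|uv|cr].
- apply: (@mismatch_le G Y Z (vertex_at d u) (vertex_at d v) false) => //.
  + exact: iota_ltn_sorted.
  + by move=> p; rewrite mem_iota => h; rewrite (followsE d uv); lia.
  + by left=> p q; rewrite !mem_iota => h h' pq; rewrite (followsE d uv); lia.
- apply: (@mismatch_le G Y Z (vertex_at d u) (vertex_at d v) true) => //.
  + exact: iota_ltn_sorted.
  + by move=> p; rewrite mem_iota => h; rewrite (followsE d uv); lia.
  + by left=> p q; rewrite !mem_iota => h h' pq; rewrite (followsE d uv); lia.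
by rewrite /cross_triple cr in ncr.
Qed.

(** In a crossing [v^(k-j)] is missed by [u^j] but seen by [u^(j+1)]. Both follow its colour, with
    at most [B] exceptions each. *)
Lemma crossing_changes u v : 5 < k -> regular_crossing u v ->
  mismatch (iota 1 k.-1) (F u) (fun j => F u j.+1) <= 2 * B.
Proof.
move=> k5 cr; have uv := followsE d cr.
apply: leq_trans (mismatch_trans (fun j => F v (k - j)) _ _ _) _.
rewrite mul2n -addnn; apply: leq_add.
  apply: (@mismatch_le G Y Z (vertex_at d u) (fun j => vertex_at d v (k - j)) true) => //.
  - exact: iota_ltn_sorted.
  - by move=> p; rewrite mem_iota => h; rewrite uv; lia.
  - by right=> p q; rewrite !mem_iota => h h' pq; rewrite uv; lia.
rewrite mismatchC.
apply: (@mismatch_le G Y Z (fun j => vertex_at d u j.+1) (fun j => vertex_at d v (k - j)) false) => //.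
- exact: iota_ltn_sorted.
- by move=> p; rewrite mem_iota => h; rewrite uv; lia.
- by left=> p q; rewrite !mem_iota => h h' pq; rewrite uv; lia.
Qed.

(** In an expanding crossing the neighbours of [u^(k+1-j)] start at index [2 * j], so reflecting [u]
    gives the same doubling as in the parallel triples. *)
Lemma expanding_transport u v m (e : bool) :
    5 < k -> odd k -> 2 * m < k -> expanding_triple u v ->
  mismatch (iota 1 m) (fun j => F u (flip k (cross_triple u v) j))
    (fun j => F v (2 * j + e)) <= B.
Proof.
move=> k5 ok mk ex; have [cr|ncr] := boolP (cross_triple u v).
  have uv := followsE d (cross_expanding k5 ok ex cr).
  apply: (@mismatch_le G Y Z (fun j => vertex_at d u (k.+1 - j))
            (fun j => vertex_at d v (2 * j + e)) false) => //.
  - exact: iota_ltn_sorted.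
  - by move=> p; rewrite mem_iota => h; rewrite uv; lia.
  - by right=> p q; rewrite !mem_iota => h h' pq; rewrite uv; lia.
case/or3P: ex => [uv|uv|cr].
- apply: (@mismatch_le G Y Z (vertex_at d u) (fun j => vertex_at d v (2 * j + e)) false) => //.
  + exact: iota_ltn_sorted.
  + by move=> p; rewrite mem_iota => h; rewrite (followsE d uv); lia.
  + by left=> p q; rewrite !mem_iota => h h' pq; rewrite (followsE d uv); lia.
- apply: (@mismatch_le G Y Z (vertex_at d u) (fun j => vertex_at d v (2 * j + e)) true) => //.
  + exact: iota_ltn_sorted.
  + by move=> p; rewrite mem_iota => h; rewrite (followsE d uv); lia.
  + by left=> p q; rewrite !mem_iota => h h' pq; rewrite (followsE d uv); lia.
by rewrite /cross_triple cr orbT in ncr.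
Qed.

(** [b] tells from which end of the second set the children are counted. Doubling acts on the first
    and the last [m] indices of the first set; a parallel triple preserves the end, a crossing
    exchanges the two. *)
Lemma skew_transport u v m (e b : bool) :
    5 < k -> 4 * m + 2 = k -> skew_expanding_triple u v ->
  mismatch (iota 1 m) (fun j => F u (flip k (cross_triple u v (+) b) j))
    (fun j => F v (flip k b (2 * j + e))) <= B.
Proof.
move=> k5 mk ex.
have [m1 m2] : (k - 2) %/ 4 = m /\ (3 * k + 2) %/ 4 = k - m by lia.
pose a j := vertex_at d u (flip k (cross_triple u v (+) b) j).
pose a' j := vertex_at d v (flip k b (2 * j + e)).
suff [dg off] : (forall p, 0 < p <= m -> adj (a p) (a' p) = true) /\
    ((forall p q, 0 < p <= m -> 0 < q <= m -> p < q -> adj (a p) (a' q) = false) \/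
     (forall p q, 0 < p <= m -> 0 < q <= m -> p < q -> adj (a q) (a' p) = false)).
  apply: (@mismatch_le G Y Z a a' false) => //.
  - exact: iota_ltn_sorted.
  - by move=> p; rewrite mem_iota => h; apply: dg; lia.
  - by case: off => off; [left|right] => p q; rewrite !mem_iota => h h' pq; apply: off; lia.
rewrite /a /a' {a a'}; have [cr|ncr] := boolP (cross_triple u v).
  have /andP[_ /(followsE d) uv] := cross_skew k5 ex cr.
  have uvl j j' : 0 < j <= m -> 0 < j' <= k ->
      adj (vertex_at d u j) (vertex_at d v j') = (k <= 2 * j + j').
    move=> hj hj'; rewrite uv //; last by lia.
    by rewrite m1; case/andP: hj => _ ->.
  have uvr j j' : k - m < j <= k -> 0 < j' <= k ->
      adj (vertex_at d u j) (vertex_at d v j') = (2 * k <= 2 * j + j' - 2).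
    move=> hj hj'; rewrite uv //; last by lia.
    by rewrite m1 m2; do 3!(case: ifP; first by lia).
  case: b => /=; split.
  - by move=> p hp; rewrite uvl; case: e; lia.
  - by left => p q hp hq pq; rewrite uvl; case: e; lia.
  - by move=> p hp; rewrite uvr; case: e; lia.
  - by right => p q hp hq pq; rewrite uvr; case: e; lia.
(* [c] is the constant value on the middle indices, so that matchings and antimatchings are treated
   at once. *)
have [c /(followsE d) uv] : exists c, follows (fun j j' =>
    if j <= (k - 2) %/ 4 then (j' == 2 * j) || (j' == 2 * j + 1)
    else if j <= (3 * k + 2) %/ 4 then c
    else (j' == 2 * j - k - 2) || (j' == 2 * j - k - 1)) u v.
  case/or3P: ex => [/andP[_ uv]|/andP[_ uv]|cr]; last by rewrite /cross_triple cr !orbT in ncr.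
    by exists false.
  by exists true.
have uvl j j' : 0 < j <= m -> 0 < j' <= k ->
    adj (vertex_at d u j) (vertex_at d v j') = (j' == 2 * j) || (j' == 2 * j + 1).
  move=> hj hj'; rewrite uv //; last by lia.
  by rewrite m1; case/andP: hj => _ ->.
have uvr j j' : k - m < j <= k -> 0 < j' <= k ->
    adj (vertex_at d u j) (vertex_at d v j')
    = (j' == 2 * j - k - 2) || (j' == 2 * j - k - 1).
  move=> hj hj'; rewrite uv //; last by lia.
  by rewrite m1 m2; do 2!(case: ifP; first by lia).
case: b => /=; split.
- by move=> p hp; rewrite uvr; case: e; lia.
- by left => p q hp hq pq; rewrite uvr; case: e; lia.
- by move=> p hp; rewrite uvl; case: e; lia.
- by left => p q hp hq pq; rewrite uvl; case: e; lia.
Qed.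

End Transport.

(** * Once around the carousel *)

Lemma sum_halves (f : nat -> nat) m p :
  \sum_(1 <= j < (m + p).+1) f j
  = \sum_(1 <= j < m.+1) f j + \sum_(1 <= j < p.+1) f ((m + p).+1 - j).
Proof.
elim: p => [|p IH]; first by rewrite addn0 [X in _ + X]big_nil addn0.
rewrite addnS big_nat_recr //= IH [X in _ = _ + X]big_nat_recl //= subSS subn0.
by rewrite -addnA [X in _ + X]addnC.
Qed.

Section Carousel.
Variables (n k : nat) (G : sgraph) (x : 'I_n -> 'I_k -> G) (d : G).
Variables (Y Z : {set G}).
Hypotheses (n0 : 2 < n) (k5 : 5 < k) (YZ : ~: Y \subset Z) (cx : carousel x).
Let B := 2 * (cutrank Y Z).+1.

Let ind (m : nat) : 'I_n := Ordinal (ltn_pmod m (ltn_trans (ltn0Sn 1) n0)).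
Let X (m : nat) := x (ind m).
Let F m j := vertex_at d (X m) j \in Y.
Let cr m := cross_triple (X m) (X m.+1).

Let XS m : x (ordS (ind m)) = X m.+1.
Proof. by congr x; apply: val_inj; rewrite /= -addn1 modnDml addn1. Qed.

Let ind_small m : m < n -> ind m = m :> nat.
Proof. exact: modn_small. Qed.

Let Xn : X n = X 0.
Proof. by congr x; apply: val_inj; rewrite /= modnn mod0n. Qed.

Lemma crossing0 : regular_crossing (X 0) (X 1).
Proof. by have [_ c0 _ _] := cx; rewrite -(XS 0); apply: c0; rewrite ind_small //; lia. Qed.

Lemma regular_step m : m < n.-1 -> regular_triple (X m) (X m.+1).
Proof.
case: m => [|m] mn; first by rewrite /regular_triple crossing0 !orbT.
by have [_ _ c1 _] := cx; rewrite -(XS m.+1); apply: c1; rewrite ind_small; lia.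
Qed.

Lemma n_crossE : n_cross x = \sum_(0 <= m < n) cr m.
Proof.
rewrite big_mkord /n_cross -sum1dep_card big_mkcond; apply: eq_bigr => i _.
have -> : cr i = cross_triple (x i) (x (ordS i)).
  rewrite /cr -(XS i) /X; have -> // : ind i = i by apply: val_inj; rewrite /= modn_small.
by case: ifP.
Qed.

(** Two reversals cancel, so only the parity of the cross triples met so far survives; each triple
    adds at most [B] exceptions. *)
Lemma transport m : m < n ->
  mismatch (iota 1 k) (F 0)
    (fun j => F m (flip k (odd (\sum_(0 <= i < m) cr i)) j)) <= m * B.
Proof.
elim: m => [|m IH] mn; first by rewrite big_nil /mismatch (eq_count (a2 := pred0)) ?count_pred0 // => j; rewrite /= eqxx.
set b := odd (\sum_(0 <= i < m) cr i) in IH.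
apply: leq_trans (mismatch_trans (fun j => F m (flip k b j)) _ _ _) _.
rewrite mulSnr; apply: leq_add; first exact: IH (ltnW mn).
rewrite big_nat_recr //= oddD -/b oddb.
have reg : regular_triple (X m) (X m.+1) by apply: regular_step; lia.
have := regular_transport d YZ k5 reg; rewrite -/B -(mismatch_flip k b); apply: leq_trans.
rewrite (@eq_in_mismatch _ _ _ (fun j => F m (flip k b j))
  (fun j => F m.+1 (flip k (cr m) (flip k b j)))) // => j.
rewrite mem_iota -/(cr m) => h; congr (F _ _).
by rewrite /flip; case: (cr m); case: (b); rewrite /=; lia.
Qed.

Lemma changes0 : mismatch (iota 1 k.-1) (F 0) (fun j => F 0 j.+1) <= 2 * B.
Proof. exact: (crossing_changes d YZ k5 crossing0). Qed.

Lemma card_colour (c : bool) : #|[set v | (v \in Y) != c]| =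
  \sum_(0 <= m < n) mismatch (iota 1 k) (F m) (fun=> c).
Proof.
have [bx _ _ _] := cx.
rewrite -sum1dep_card big_mkcond (reindex _ (onW_bij _ bx)) /=.
rewrite -(pair_bigA _ (fun i j => if (x i j \in Y) != c then 1 else 0)) /=.
rewrite big_mkord; apply: eq_bigr => i _.
rewrite mismatchE big_add1 big_mkord; apply: eq_bigr => j _.
have -> : F i j.+1 = (x i j \in Y).
  by rewrite /F vertex_atE /X; have -> // : ind i = i by apply: val_inj; rewrite /= modn_small.
by case: ifP.
Qed.

Lemma card_carousel : #|G| = n * k.
Proof.
have [bx _ _ _] := cx.
by rewrite -(bij_eq_card bx) card_prod !card_ord.
Qed.

(** Each of the [n] sets inherits the colour of [X 0] with at most [n * B] further exceptions, so
    balance gives [32 * k <= 27 * (k + 2) + 96 * (n * B)]. *)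
Lemma unbalanced (c : bool) :
    32 * mismatch (iota 1 k) (F 0) (fun=> c) <= 9 * (k + 2) ->
    #|G| <= 3 * #|[set v | (v \in Y) != c]| ->
  5 * k <= 54 + 96 * (n * B).
Proof.
move=> h0; rewrite card_colour card_carousel.
set a := mismatch _ (F 0) _ in h0.
have le m : m < n -> mismatch (iota 1 k) (F m) (fun=> c) <= a + n * B.
  move=> mn; rewrite -(mismatch_flip k (odd (\sum_(0 <= i < m) cr i)) (F m)).
  apply: leq_trans (mismatch_trans (F 0) _ _ _) _; rewrite addnC leq_add2l mismatchC.
  by apply: leq_trans (transport mn) _; rewrite leq_mul2r (ltnW mn) orbT.
have : \sum_(0 <= m < n) mismatch (iota 1 k) (F m) (fun=> c)
    <= \sum_(0 <= m < n) (a + n * B).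
  by rewrite big_nat [X in _ <= X]big_nat; apply: leq_sum => m /andP[_]; apply: le.
rewrite sum_nat_const_nat subn0; set S := \sum_(0 <= m < n) _ => le1 le2.
have : n * k <= n * (3 * (a + n * B)) by lia.
by rewrite leq_pmul2l; lia.
Qed.

Let last_cross : odd (n_cross x) = odd (\sum_(0 <= m < n.-1) cr m) (+) cr n.-1.
Proof. by rewrite n_crossE -[in LHS](prednK (ltn_trans (ltn0Sn 1) n0)) big_nat_recr //= oddD oddb. Qed.

Let last_triple : x (ordS (ind n.-1)) = X 0.
Proof. by rewrite XS prednK ?Xn //; lia. Qed.

Let crn : cr n.-1 = cross_triple (X n.-1) (X 0).
Proof. by rewrite /cr prednK ?Xn //; lia. Qed.

(** The parity accumulated before the last triple equals that of the last triple, so the two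
    reflections cancel. *)
Lemma even_tree s (e : bool) : k = 2 ^ s - 1 -> ~~ odd (n_cross x) ->
    expanding_triple (X n.-1) (X 0) ->
  mismatch (iota 1 (2 ^ s.-1 - 1)) (F 0) (fun j => F 0 (2 * j + e)) <= n * B.
Proof.
move=> kE ev ex; case: s kE => [|s] kE; first by move: k5; rewrite kE.
have s2 : 0 < 2 ^ s by rewrite expn_gt0.
rewrite -[s.+1.-1]/s; rewrite expnS in kE.
have n1 : n.-1 < n by lia.
apply: leq_trans (mismatch_trans (fun j => F n.-1 (flip k (cr n.-1) j)) _ _ _) _.
have -> : n * B = n.-1 * B + B by rewrite -mulSnr prednK //; lia.
apply: leq_add; last by rewrite crn; apply: expanding_transport => //; lia.
apply: leq_trans (mismatch_prefix _ _ (_ : _ <= k)) _; first by rewrite /=; lia.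
have := transport n1; move: ev; rewrite last_cross.
by case: (odd _); case: (cr _).
Qed.

(** The parity accumulated before the last triple is opposite to that of the last triple. One
    reflection survives: a node counted from one end of [X 0] is matched with children counted from
    the other. *)
Lemma odd_tree s (e b : bool) : k = 2 * (2 ^ s - 1) -> odd (n_cross x) ->
    skew_expanding_triple (X n.-1) (X 0) ->
  mismatch (iota 1 (2 ^ s.-1 - 1)) (fun j => F 0 (flip k (~~ b) j))
    (fun j => F 0 (flip k b (2 * j + e))) <= n * B.
Proof.
move=> kE od ex; case: s kE => [|s] kE; first by move: k5; rewrite kE.
have s2 : 0 < 2 ^ s by rewrite expn_gt0.
rewrite -[s.+1.-1]/s; rewrite expnS in kE.
have n1 : n.-1 < n by lia.
apply: leq_trans (mismatch_trans (fun j => F n.-1 (flip k (cr n.-1 (+) b) j)) _ _ _) _.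
have -> : n * B = n.-1 * B + B by rewrite -mulSnr prednK //; lia.
apply: leq_add; last by rewrite crn; apply: skew_transport => //=; lia.
apply: leq_trans (mismatch_prefix _ _ (_ : _ <= k)) _; first by rewrite /=; lia.
have par : odd (\sum_(0 <= m < n.-1) cr m) = ~~ cr n.-1.
  by move: od; rewrite last_cross; case: (odd _); case: (cr _).
have := transport n1; rewrite par -(mismatch_flip k (~~ b)); apply: leq_trans.
rewrite (@eq_in_mismatch _ _ _ (fun j => F 0 (flip k (~~ b) j))
  (fun j => F n.-1 (flip k (~~ cr n.-1) (flip k (~~ b) j)))) // => j.
rewrite mem_iota => h; congr (F _ _).
by rewrite /flip; case: (cr n.-1); case: b; rewrite /=; lia.
Qed.

Variables (C D l0 s : nat).
Hypotheses (CB : 2 * B <= C) (DB : n * B <= D).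
Hypotheses (l0D : 8 * (2 * D + 1) <= 2 ^ l0) (sE : s = l0 + 2 * (2 * C + 1) + 1).
Hypothesis balanced : forall c : bool, #|G| <= 3 * #|[set v | (v \in Y) != c]|.

Lemma even_carousel_card : k = 2 ^ s - 1 -> ~~ odd (n_cross x) ->
    (forall i : 'I_n, i = n.-1 :> nat -> expanding_triple (x i) (x (ordS i))) ->
  5 * k <= 54 + 96 * (n * B).
Proof.
move=> kE ev ex.
have exn : expanding_triple (X n.-1) (X 0).
  by rewrite -last_triple; apply: ex; rewrite ind_small //; lia.
have ch : mismatch (iota 1 (2 ^ s - 2)) (F 0) (fun j => F 0 j.+1) <= C.
  by apply: leq_trans CB; have -> : 2 ^ s - 2 = k.-1 by [lia]; apply: changes0.
have tr (e : bool) : mismatch (iota 1 (2 ^ s.-1 - 1)) (F 0) (fun j => F 0 (2 * j + e)) <= D.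
  exact: leq_trans (even_tree e kE ev exn) DB.
(* A single tree serves as both colourings, so every wrong index is counted twice. *)
have [c hc] := dominant_colour ch ch tr tr l0D sE.
apply: (unbalanced (c := c)) (balanced c); rewrite mismatchE.
have k1 : k.+1 = 2 ^ s by lia.
rewrite -k1 big_split /= in hc; rewrite k1; rewrite k1 in hc; lia.
Qed.

(** The two halves of [X 0], the second read backwards as [R], are the two trees of [2 ^ s - 1]
    nodes. *)
Lemma odd_carousel_card : k = 2 * (2 ^ s - 1) -> odd (n_cross x) ->
    (forall i : 'I_n, i = n.-1 :> nat -> skew_expanding_triple (x i) (x (ordS i))) ->
  5 * k <= 54 + 96 * (n * B).
Proof.
move=> kE od ex.
have exn : skew_expanding_triple (X n.-1) (X 0).
  by rewrite -last_triple; apply: ex; rewrite ind_small //; lia.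
pose R j := F 0 (k.+1 - j).
have sk : 2 ^ s - 2 <= k.-1 by lia.
have chL : mismatch (iota 1 (2 ^ s - 2)) (F 0) (fun j => F 0 j.+1) <= C.
  exact: leq_trans (mismatch_prefix _ _ sk) (leq_trans changes0 CB).
have chR : mismatch (iota 1 (2 ^ s - 2)) R (fun j => R j.+1) <= C.
  apply: leq_trans (mismatch_prefix _ _ sk) (leq_trans _ CB).
  apply: leq_trans changes0; rewrite mismatchC -[X in _ <= X]mismatch_rev.
  rewrite (@eq_in_mismatch _ _ _ (fun j => F 0 (k.-1.+1 - j))
    (fun j => F 0 (k.-1.+1 - j).+1)) // => j; rewrite mem_iota => h; congr (F _ _); lia.
have LR (e : bool) : mismatch (iota 1 (2 ^ s.-1 - 1)) (F 0) (fun j => R (2 * j + e)) <= D.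
  exact: leq_trans (odd_tree e true kE od exn) DB.
have RL (e : bool) : mismatch (iota 1 (2 ^ s.-1 - 1)) R (fun j => F 0 (2 * j + e)) <= D.
  exact: leq_trans (odd_tree e false kE od exn) DB.
have [c hc] := dominant_colour chL chR LR RL l0D sE.
apply: (unbalanced (c := c)) (balanced c); rewrite mismatchE.
have k1 : (2 ^ s - 1).+1 = 2 ^ s by lia.
have k2 : 2 ^ s - 1 + (2 ^ s - 1) = k by lia.
rewrite -k1 big_split /= in hc.
have := sum_halves (fun j => F 0 j != c : nat) (2 ^ s - 1) (2 ^ s - 1).
rewrite k2 => ->; move: hc; rewrite /R; lia.
Qed.

End Carousel.

(** * From balanced cuts to rankwidth *)

Lemma rankwidth_ge (G : sgraph) r : 3 < #|G| ->
    (forall Y Z : {set G}, ~: Y \subset Z ->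
       (forall c : bool, #|G| <= 3 * #|[set v | (v \in Y) != c]|) ->
     r <= cutrank Y Z) ->
  r <= rankwidth G.
Proof.
move=> nG H; rewrite /rankwidth; case: ex_minnP => w /asboolP[[le1 _]|[D <-]] _; first by lia.
have [a [b [ab big1 big2]]] := balanced_edge D nG.
apply: leq_trans (_ : cutrank (td_side a b) (td_side b a) <= _); last first.
  exact: (leq_bigmax_cond (a, b)).
apply: H => [|c].
  apply/subsetP => v; rewrite !inE => h; have [cT _ _ _] := td_cubic D.
  by have := subsetP (side_cover a b cT) (td_leaf D v); rewrite !inE => ->.
case: c; [move: big2 | move: big1]; congr (_ <= 3 * _); apply: eq_card => v; rewrite !inE.
- by case: (connect _ _ _).
- by case: (connect _ _ _).
Qed.

Theorem theorem5 (n r : nat) (hn : 3 <= n) (hr : 1 <= r) :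
  exists s : nat, 1 <= s /\
    (forall G : sgraph, even_carousel n s G -> r <= rankwidth G) /\
    (forall G : sgraph, odd_carousel n s G -> r <= rankwidth G).
Proof.
(* For a cut-rank [w < r], [C] bounds [2 * B] and [D] bounds [n * B]. The factor 40 in [l0] serves
   both [l0D] and the final contradiction, where [2 ^ s > l0 + 1] makes [5 * k] exceed
   [54 + 96 * D]. *)
pose C := 4 * r; pose D := 2 * n * r; pose l0 := 40 * (D + 1).
pose s := l0 + 2 * (2 * C + 1) + 1.
have l0D : 8 * (2 * D + 1) <= 2 ^ l0.
  by apply: leq_trans (ltnW (ltn_expl l0 _)) => //; rewrite /l0; lia.
have sl : l0 + 1 < 2 ^ s.
  by apply: leq_ltn_trans (ltn_expl s _) => //; rewrite /s; lia.
have [CB DB] : (forall w, w < r -> 2 * (2 * w.+1) <= C) /\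
               (forall w, w < r -> n * (2 * w.+1) <= D).
  by split=> w wr; rewrite /C /D; nia.
exists s; split; first by rewrite /s addn1.
split=> G [x [cx par ex]].
- have k5 : 5 < 2 ^ s - 1 by rewrite /l0 in sl; lia.
  have cG := card_carousel cx.
  have nG : 3 < #|G| by rewrite cG; nia.
  have /card_gt0P[d _] : 0 < #|G| by lia.
  apply: rankwidth_ge => // Y Z YZ bal; rewrite leqNgt; apply/negP => wr.
  have := even_carousel_card d hn k5 YZ cx (CB _ wr) (DB _ wr) l0D erefl bal erefl par ex.
  by have := DB _ wr; rewrite /l0 in sl; lia.
- have k5 : 5 < 2 * (2 ^ s - 1) by rewrite /l0 in sl; lia.
  have cG := card_carousel cx.
  have nG : 3 < #|G| by rewrite cG; nia.
  have /card_gt0P[d _] : 0 < #|G| by lia.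
  apply: rankwidth_ge => // Y Z YZ bal; rewrite leqNgt; apply/negP => wr.
  have := odd_carousel_card d hn k5 YZ cx (CB _ wr) (DB _ wr) l0D erefl bal erefl par ex.
  by have := DB _ wr; rewrite /l0 in sl; lia.
Qed.
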